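(* Let $G$ be a finite non-abelian group. Then $G$ is a CA-group if and only if for any pair of non-central elements $x,y\in G$ such that $C_G(x)\neq C_G(y)$ one has $C_G(x)\cap C_G(y)=Z(G)$.
   Context: $C_G(x)$ denotes the centraliser of $x$ in $G$ and $Z(G)$ the centre of $G$. A finite group $G$ is a CA-group if $C_G(x)$ is abelian for every non-central element $x\in G$. *)

(* Defs.v *)
From mathcomp Require Import all_boot all_fingroup all_solvable.

Set Implicit Arguments.
Unset Strict Implicit.
Unset Printing Implicit Defensive.

Import GroupScope.

Definition CA_group (gT : finGroupType) (G : {group gT}) : Prop :=
  forall x : gT, x \in G -> x \notin 'Z(G) -> abelian 'C_G[x].

(* Main.v *)
(** In a CA-group, a non-central [z] in ['C_G[x]] has ['C_G[z] = 'C_G[x]], so two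
    distinct centralisers share only central elements. Conversely, a non-central
    [a] in ['C_G[x]] satisfies [x \in 'C_G[a] :&: 'C_G[x]], and [x] is not central,
    which forces ['C_G[a] = 'C_G[x]]. *)
Require Import Defs.
From mathcomp Require Import all_boot all_fingroup all_solvable.

Import GroupScope.

Lemma abelian_subcent1_sub (gT : finGroupType) (G : {group gT}) (x z : gT) :
  abelian 'C_G[x] -> z \in 'C_G[x] -> 'C_G[x] \subset 'C_G[z].
Proof.
move=> abCx Cxz; apply/subsetP=> w Cxw; apply/subcent1P; split.
  by case/subcent1P: Cxw.
exact: (centsP abCx).
Qed.

(** Commuting is symmetric, so [x] also lies in ['C_G[z]]; both centralisers are abelian, hence each
    is contained in the other. *)
Lemma CA_group_subcent1_eq (gT : finGroupType) (G : {group gT}) (x z : gT) :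
  CA_group G -> x \in G -> x \notin 'Z(G) -> z \notin 'Z(G) ->
  z \in 'C_G[x] -> 'C_G[x] = 'C_G[z].
Proof.
move=> caG Gx nZx nZz Cxz; have /subcent1P[Gz cxz] := Cxz.
have Czx : x \in 'C_G[z] by apply/subcent1P; split=> //; apply: commute_sym.
by apply/eqP; rewrite eqEsubset !abelian_subcent1_sub //; apply: caG.
Qed.

Lemma center_sub_subcent1 (gT : finGroupType) (G : {group gT}) (x : gT) :
  x \in G -> 'Z(G) \subset 'C_G[x].
Proof. by move=> Gx; rewrite setIS // -cent_set1 centS ?sub1set. Qed.

Theorem lemma2p1 (gT : finGroupType) (G : {group gT}) (nabG : ~~ abelian G) :
  CA_group G <->
  (forall x y : gT,
     x \in G -> x \notin 'Z(G) ->
     y \in G -> y \notin 'Z(G) ->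
     'C_G[x] <> 'C_G[y] ->
     'C_G[x] :&: 'C_G[y] = 'Z(G)).
Proof.
split=> [caG x y Gx nZx Gy nZy neqC | trivI x Gx nZx].
  apply/eqP; rewrite eqEsubset subsetI !center_sub_subcent1 // !andbT.
  apply/subsetP=> z /setIP[Cxz Cyz]; apply/negPn/negP=> nZz; apply: neqC.
  rewrite (CA_group_subcent1_eq gT G x z) //.
  by rewrite (CA_group_subcent1_eq gT G y z).
apply/centsP=> a Cxa b Cxb; have /subcent1P[Ga cxa] := Cxa.
(* [trivI] only concerns non-central elements, so a central [a] is treated apart. *)
have [/centerP[_ cGa] | nZa] := boolP (a \in 'Z(G)).
  by apply: cGa; case/subcent1P: Cxb.
(* Equality of the centralisers puts [b] in ['C_G[a]], which is the required commutation of [a] and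
   [b]. *)
suff eqC : 'C_G[a] = 'C_G[x] by move: Cxb; rewrite -eqC => /subcent1P[].
have [// | /eqP neqC] := eqVneq 'C_G[a] 'C_G[x].
case/negP: (nZx); rewrite -(trivI a x Ga nZa Gx nZx neqC) inE.
by apply/andP; split; apply/subcent1P; split=> //; apply: commute_sym.
Qed.
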